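(* (a) Let $(V,\boldsymbol{\Omega},q)$ be a complex vector space equipped with a non-degenerate $k$-symplectic structure. Then $V$ is a $\mathcal{C}l^0(\boldsymbol{\Omega},q)$-module. (b) Let $(V,\boldsymbol{\Omega},q)$ be a vector space with a non-degenerate real $k$-symplectic structure where the real quadratic form $q$ has signature $(r,s)$ (that is, $r$ minuses and $s$ pluses). Then the corresponding real vector space $V_{\mathbb{R}}$ has a structure of a $\mathcal{C}l_{r-1,s}$-module if $r>0$, and of a $\mathcal{C}l_{s-1,r}$-module if $s>0$.
   Context: Let $V$ be a complex vector space of dimension $4n$ and $k$ a non-negative integer. A $k$-symplectic structure on $V$ is a subspace $\boldsymbol{\Omega}\subset\Lambda^2V^*$ of dimension $k$ such that for some non-zero quadratic form $q\in S^2\boldsymbol{\Omega}^*$ the following holds: for any non-zero $\omega\in\boldsymbol{\Omega}$, $\dim(\ker\omega)=2n$ if $q(\omega)=0$, and $\dim(\ker\omega)=0$ otherwise. It is non-degenerate if $q$ is non-degenerate. The form $q$ is unique up to a non-zero scalar, and the structure is denoted $(\boldsymbol{\Omega},q)$. The structure is real if $V=V_{\mathbb{R}}\otimes\mathbb{C}$ for a real vector space $V_{\mathbb{R}}$, $\boldsymbol{\Omega}=\boldsymbol{\Omega}_{\mathbb{R}}\otimes\mathbb{C}$ for a real subspace $\boldsymbol{\Omega}_{\mathbb{R}}\subset\Lambda^2V_{\mathbb{R}}^*$, and $q$ is a real quadratic form. For a (real or complex) vector space $E$ with quadratic form $q$, the Clifford algebra $\mathcal{C}l(E,q)$ is the quotient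 of the tensor algebra of $E$ by the two-sided ideal generated by $x\otimes x-q(x,x)\cdot 1$, $x\in E$; it is $\mathbb{Z}/2$-graded, and $\mathcal{C}l^0(E,q)$ is its even part. $\mathcal{C}l_{r,s}$ denotes the Clifford algebra of a real $(r+s)$-dimensional vector space with a non-degenerate quadratic form having $r$ minuses and $s$ pluses. Modules are unital. *)

(* Defs.v *)
From HB Require Import structures.
From mathcomp Require Import all_boot all_order all_algebra.
From mathcomp Require Import ring_quotient.
From mathcomp Require Import boolp reals complex.
From mathcomp Require Import finmap monalg.

Set Implicit Arguments.
Unset Strict Implicit.
Unset Printing Implicit Defensive.

Import GRing.Theory.
Local Open Scope ring_scope.
Local Open Scope quotient_scope.

Section Forms.
Variables (F : fieldType) (E : vectType F).

(* A bilinear form w on E is identified with the linear map x |-> w(x, -) from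
   E to its dual, so that [lker w] is its kernel. *)
Definition bilform := 'Hom(E, 'Hom(E, F^o)).

Definition alternating_form (w : bilform) : Prop := forall x, w x x = 0.

(* In characteristic different from 2, quadratic forms are the same thing as
   symmetric bilinear forms; x |-> q x x is the associated quadratic map. *)
Definition symmetric_form (q : bilform) : Prop := forall x y, q x y = q y x.

Definition nondegenerate_form (q : bilform) : Prop := lker q = 0%VS.

End Forms.

(* [quot_alg G] is the quotient of the algebra A by the two-sided ideal
   generated by G.  It is only given the structures of a possibly trivial ring
   and of a module over F, since G may generate the unit ideal. *)
Section QuotientAlgebra.
Variables (F : fieldType) (A : lalgType F).

Definition two_sided_ideal (J : A -> Prop) : Prop :=
  [/\ J 0, forall x y, J x -> J y -> J (x + y)
    & forall a x b, J x -> J (a * x * b)].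

Definition ideal_gen (G : A -> Prop) : {pred A} := fun x =>
  `[< forall J, two_sided_ideal J -> (forall g, G g -> J g) -> J x >].

Variable G : A -> Prop.

Lemma mem_ideal_gen g : G g -> g \in ideal_gen G.
Proof. by move=> Gg; apply/asboolP => J _ GJ; exact: GJ. Qed.

Lemma ideal_genD : {in ideal_gen G &, forall x y, x + y \in ideal_gen G}.
Proof.
move=> x y /asboolP xI /asboolP yI; apply/asboolP => J JI GJ.
by case: (JI) => _ JD _; apply: JD; [exact: xI | exact: yI].
Qed.

Lemma ideal_genM a b : {in ideal_gen G, forall x, a * x * b \in ideal_gen G}.
Proof.
move=> x /asboolP xI; apply/asboolP => J JI GJ.
by case: (JI) => _ _ JM; apply: JM; exact: xI.
Qed.

Lemma ideal_genMl a : {in ideal_gen G, forall x, a * x \in ideal_gen G}.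
Proof. by move=> x xI; rewrite -[a * x]mulr1 ideal_genM. Qed.

Lemma ideal_genMr b : {in ideal_gen G, forall x, x * b \in ideal_gen G}.
Proof. by move=> x xI; rewrite -[x]mul1r ideal_genM. Qed.

Lemma ideal_gen_zmod_closed : zmod_closed (ideal_gen G).
Proof.
split=> [|x y xI yI]; first by apply/asboolP => J [].
by rewrite ideal_genD // -mulN1r ideal_genMl.
Qed.

HB.instance Definition _ :=
  GRing.isZmodClosed.Build A (ideal_gen G) ideal_gen_zmod_closed.

Definition quot_alg := Quotient.quot (ideal_gen G).
HB.instance Definition _ := GRing.Zmodule.on quot_alg.

Definition quot_pi : A -> quot_alg := \pi_(Quotient.quot (ideal_gen G)).

Lemma quot_pi_eq x y : (quot_pi x = quot_pi y) <-> (x - y \in ideal_gen G).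
Proof. by rewrite Quotient.idealrBE; split=> [e|/eqP //]; apply/eqP. Qed.

Lemma quot_piP (u : quot_alg) : {x | u = quot_pi x}.
Proof. by exists (repr u); rewrite /quot_pi reprK. Qed.

Lemma quot_piD x y : quot_pi (x + y) = quot_pi x + quot_pi y.
Proof. exact: (raddfD (\pi_(Quotient.quot (ideal_gen G)))). Qed.

Lemma quot_repr x : repr (quot_pi x) - x \in ideal_gen G.
Proof. by apply/quot_pi_eq; rewrite /quot_pi reprK. Qed.

Definition quot_one : quot_alg := quot_pi 1.
Definition quot_mul (u v : quot_alg) : quot_alg := quot_pi (repr u * repr v).
Definition quot_scale (c : F) (u : quot_alg) : quot_alg :=
  quot_pi (c *: repr u).

Lemma quot_mulE x y : quot_mul (quot_pi x) (quot_pi y) = quot_pi (x * y).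
Proof.
apply/quot_pi_eq; set x' := repr _; set y' := repr _.
have -> : x' * y' - x * y = (x' - x) * y' + x * (y' - y).
  by rewrite mulrBl mulrBr addrA subrK.
by apply: ideal_genD; [apply: ideal_genMr|apply: ideal_genMl]; exact: quot_repr.
Qed.

Lemma quot_scaleE c x : quot_scale c (quot_pi x) = quot_pi (c *: x).
Proof.
apply/quot_pi_eq; rewrite -scalerBr -[_ - x]mul1r scalerAl.
by apply: ideal_genMl; exact: quot_repr.
Qed.

Fact quot_mulA : associative quot_mul.
Proof.
move=> u v w; have [x ->] := quot_piP u; have [y ->] := quot_piP v.
by have [z ->] := quot_piP w; rewrite !quot_mulE mulrA.
Qed.

Fact quot_mul1l : left_id quot_one quot_mul.
Proof. by move=> u; have [x ->] := quot_piP u; rewrite quot_mulE mul1r. Qed.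

Fact quot_mul1r : right_id quot_one quot_mul.
Proof. by move=> u; have [x ->] := quot_piP u; rewrite quot_mulE mulr1. Qed.

Fact quot_mulDl : left_distributive quot_mul +%R.
Proof.
move=> u v w; have [x ->] := quot_piP u; have [y ->] := quot_piP v.
by have [z ->] := quot_piP w; rewrite -quot_piD !quot_mulE mulrDl quot_piD.
Qed.

Fact quot_mulDr : right_distributive quot_mul +%R.
Proof.
move=> u v w; have [x ->] := quot_piP u; have [y ->] := quot_piP v.
by have [z ->] := quot_piP w; rewrite -quot_piD !quot_mulE mulrDr quot_piD.
Qed.

HB.instance Definition _ := GRing.Zmodule_isPzRing.Build quot_alg
  quot_mulA quot_mul1l quot_mul1r quot_mulDl quot_mulDr.

Fact quot_scaleA a b u :
  quot_scale a (quot_scale b u) = quot_scale (a * b) u.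
Proof. by have [x ->] := quot_piP u; rewrite !quot_scaleE scalerA. Qed.

Fact quot_scale1 : left_id 1 quot_scale.
Proof. by move=> u; have [x ->] := quot_piP u; rewrite quot_scaleE scale1r. Qed.

Fact quot_scaleDr : right_distributive quot_scale +%R.
Proof.
move=> a u v; have [x ->] := quot_piP u; have [y ->] := quot_piP v.
by rewrite -quot_piD !quot_scaleE scalerDr quot_piD.
Qed.

Fact quot_scaleDl u : {morph quot_scale^~ u : a b / a + b}.
Proof.
by move=> a b; have [x ->] := quot_piP u; rewrite !quot_scaleE scalerDl quot_piD.
Qed.

HB.instance Definition _ := GRing.Zmodule_isLmodule.Build F quot_alg
  quot_scaleA quot_scale1 quot_scaleDr quot_scaleDl.

Lemma quot_pi1 : quot_pi 1 = 1. Proof. by []. Qed.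

Lemma quot_piM x y : quot_pi (x * y) = quot_pi x * quot_pi y.
Proof. by rewrite -quot_mulE. Qed.

Lemma quot_piZ c x : quot_pi (c *: x) = c *: quot_pi x.
Proof. by rewrite -quot_scaleE. Qed.

End QuotientAlgebra.

Section Clifford.
Variables (F : fieldType) (E : vectType F).

(* The tensor algebra of E, as the free associative algebra on a basis of E:
   the words of length m form a basis of the m-th tensor power of E. *)
Definition tensor_alg := {malg F[{fmonom 'I_(\dim {:E})}]}.
HB.instance Definition _ := GRing.Lalgebra.on tensor_alg.

Definition tensor_in (x : E) : tensor_alg :=
  \sum_i coord (vbasis {:E}) i x *: << fmu i >>.

Definition even_tensor (t : tensor_alg) : Prop :=
  forall m, m \in msupp t -> ~~ odd (fdeg m).

Variable q : bilform E.

Definition clifford_rel (t : tensor_alg) : Prop :=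
  exists x : E, t = tensor_in x * tensor_in x - (q x x : F) *: 1.

Definition clifford := quot_alg clifford_rel.
HB.instance Definition _ := GRing.PzRing.on clifford.
HB.instance Definition _ := GRing.Lmodule.on clifford.

Definition even_part : {pred clifford} := fun u =>
  `[< exists2 t, even_tensor t & u = quot_pi clifford_rel t >].

Lemma even_tensorZD c (s t : tensor_alg) :
  even_tensor s -> even_tensor t -> even_tensor (c *: s + t).
Proof.
move=> es et m; rewrite -mcoeff_neq0 mcoeffD mcoeffZ => nz.
have [s0|snz] := eqVneq s@_m 0; last by apply: es; rewrite -mcoeff_neq0.
by apply: et; rewrite -mcoeff_neq0; move: nz; rewrite s0 mulr0 add0r.
Qed.

Lemma even_tensorM (s t : tensor_alg) :
  even_tensor s -> even_tensor t -> even_tensor (s * t).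
Proof.
move=> es et m mst.
have /imfset2P [/= m1 m1s [m2 m2t ->]] := fsubsetP (msuppM_incl s t) m mst.
by rewrite fdegM oddD (negbTE (es _ m1s)) (negbTE (et _ m2t)).
Qed.

Lemma even_tensor1 : even_tensor 1.
Proof. by move=> m; rewrite msuppU1 inE => /eqP ->; rewrite fdeg1. Qed.

Lemma even_part_subring_closed : subring_closed even_part.
Proof.
split=> [|u v /asboolP[s es ->] /asboolP[t et ->]|
          u v /asboolP[s es ->] /asboolP[t et ->]]; apply/asboolP.
- by exists 1; first exact: even_tensor1.
- exists (-1 *: t + s); first exact: even_tensorZD.
  by rewrite quot_piD quot_piZ scaleN1r addrC.
- by exists (s * t); [exact: even_tensorM | rewrite quot_piM].
Qed.

Lemma even_part_submod_closed : submod_closed even_part.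
Proof.
split=> [|c u v /asboolP[s es ->] /asboolP[t et ->]]; apply/asboolP.
  exists 0; last by rewrite -(scale0r (0 : tensor_alg)) quot_piZ scale0r.
  by move=> m; rewrite msupp0.
by exists (c *: s + t); [exact: even_tensorZD | rewrite quot_piD quot_piZ].
Qed.

HB.instance Definition _ :=
  GRing.isSubringClosed.Build clifford even_part even_part_subring_closed.
HB.instance Definition _ :=
  GRing.isSubmodClosed.Build F clifford even_part even_part_submod_closed.

Record even_clifford : predArgType :=
  EvenClifford { even_val : clifford; _ : even_val \in even_part }.
HB.instance Definition _ := [isSub for even_val].
HB.instance Definition _ := [Choice of even_clifford by <:].
HB.instance Definition _ := [SubChoice_isSubZmodule of even_clifford by <:].
HB.instance Definition _ := 
  GRing.SubZmodule_isSubPzRing.Build clifford even_part even_clifford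
    even_part_subring_closed.
HB.instance Definition _ := [SubZmodule_isSubLmodule of even_clifford by <:].

End Clifford.

(* Together with the F-linearity of rho, this makes V a unital A-module whose
   underlying F-vector space is the given one. *)
Definition unital_action (F : fieldType) (A : pzRingType) (V : vectType F)
    (rho : A -> 'End(V)) : Prop :=
  rho 1 = \1%VF /\ forall a b, rho (a * b) = (rho a \o rho b)%VF.

Section RealForms.
Variable R : realType.

Definition std_form (r s : nat) : bilform 'rV[R]_(r + s) :=
  linfun (fun x : 'rV[R]_(r + s) => linfun (fun y : 'rV[R]_(r + s) =>
    (\sum_(i < r + s) (-1) ^+ (i < r)%N * x 0 i * y 0 i) : R^o)).

Lemma std_formE r s (x y : 'rV[R]_(r + s)) :
  std_form r s x y = \sum_(i < r + s) (-1) ^+ (i < r)%N * x 0 i * y 0 i.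
Proof.
pose g (x y : 'rV[R]_(r + s)) : R^o :=
  \sum_(i < r + s) (-1) ^+ (i < r)%N * x 0 i * y 0 i.
have gL z : linear (g z).
  move=> c u v; rewrite /g /GRing.scale /= mulr_sumr -big_split /=.
  by apply: eq_bigr => i _; rewrite !mxE mulrDr mulrCA.
pose gLin z : {linear _ -> _} :=
  HB.pack (g z) (GRing.isLinear.Build _ _ _ _ (g z) (gL z)).
have linE z u : linfun (g z) u = g z u by exact: (lfunE (gLin z)).
have hL : linear (fun z => linfun (g z)).
  move=> c u v; apply/lfunP => w; rewrite add_lfunE scale_lfunE !linE /g.
  rewrite /GRing.scale /= mulr_sumr -big_split /=; apply: eq_bigr => i _.
  by rewrite !mxE mulrDr mulrDl mulrCA !mulrA.
pose hLin : {linear _ -> _} := HB.pack (fun z => linfun (g z))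
  (GRing.isLinear.Build _ _ _ _ (fun z => linfun (g z)) hL).
rewrite -[RHS]/(g x y) -linE; congr (fun_of_lfun _ y).
exact: (lfunE hLin).
Qed.

(* Cl_{r,s}: r minuses and s pluses. *)
Definition Cl (r s : nat) := clifford (std_form r s).
HB.instance Definition _ r s := GRing.PzRing.on (Cl r s).
HB.instance Definition _ r s := GRing.Lmodule.on (Cl r s).

(* r minuses and s pluses in an orthogonal basis *)
Definition has_signature (E : vectType R) (q : bilform E) (r s : nat) : Prop :=
  exists2 e : (r + s).-tuple E, basis_of {:E} e
    & forall i j : 'I_(r + s),
        q (tnth e i) (tnth e j) = if i == j then (-1) ^+ (i < r)%N else 0.

(* iota exhibits the complex vector space V as the tensor product of W and C
   over R.  As C = R + iR, that tensor product is the direct sum of W and iW,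
   with x + iy standing for x ⊗ 1 + y ⊗ i. *)
Definition is_complexification (W : vectType R) (V : vectType R[i])
    (iota : W -> V) : Prop :=
  (forall (c : R) x y, iota (c *: x + y) = (c%:C)%C *: iota x + iota y)
  /\ bijective (fun p : W * W => iota p.1 + 'i%C *: iota p.2).

End RealForms.

Section KSymplectic.
Variable R : realType.

Record is_ksymplectic (n k : nat) (V : vectType R[i])
    (Omega : {vspace bilform V}) (q : bilform (subvs_of Omega)) : Prop := {
  ksymp_dimV : \dim {:V} = (4 * n)%N;
  ksymp_alt : forall w, w \in Omega -> alternating_form w;
  ksymp_dim : \dim Omega = k;
  ksymp_sym : symmetric_form q;
  ksymp_neq0 : q != 0;
  ksymp_ker : forall w : subvs_of Omega, w != 0 ->
    \dim (lker (vsval w)) = if q w w == 0 then (2 * n)%N else 0%N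
}.

(* iOmega is the inclusion of Omega_R in its complexification Omega; the
   complex form iOmega w is the C-bilinear extension of the real form w, and
   q is the C-bilinear extension of the real quadratic form qR. *)
Record is_real_structure (V : vectType R[i]) (Omega : {vspace bilform V})
    (q : bilform (subvs_of Omega))
    (VR : vectType R) (iV : VR -> V) (OmegaR : {vspace bilform VR})
    (iOmega : subvs_of OmegaR -> subvs_of Omega)
    (qR : bilform (subvs_of OmegaR)) : Prop := {
  real_V : is_complexification iV;
  real_alt : forall w, w \in OmegaR -> alternating_form w;
  real_Omega : is_complexification iOmega;
  real_OmegaE : forall (w : subvs_of OmegaR) x y,
    vsval (iOmega w) (iV x) (iV y) = ((vsval w x y : R)%:C)%C;
  real_sym : symmetric_form qR;
  real_qE : forall w1 w2, q (iOmega w1) (iOmega w2) = ((qR w1 w2 : R)%:C)%C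
}.

End KSymplectic.

(* Main.v *)
Require Import Defs.
From HB Require Import structures.
From mathcomp Require Import all_boot all_order all_algebra.
From mathcomp Require Import boolp reals complex finmap monalg ring.

(* Fix w0 in Omega with q(w0) <> 0.  It is invertible as a map V -> V^*, so
   every w in Omega gives an endomorphism A_w = w0^-1 w of V.  If w is
   q-orthogonal to w0 and q(w) <> 0, the pencil w - t w0 has two distinct
   isotropic members, at t^2 = - q(w) / q(w0); their kernels are complementary
   eigenspaces of A_w of dimension 2n, whence q(w0) A_w^2 = - q(w).  Both sides
   being quadratic in w, this extends to all w orthogonal to w0.

   For (a), the operators f(x) = A_x and g(x) = 2 q(w0, x) - q(w0) A_x satisfy
   f(x) g(x) = g(x) f(x) = q(x), so x |-> ((u, v) |-> (g(x) v, f(x) u)) is a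
   Clifford action on V + V whose even part preserves the first summand.  For
   (b), take w0 real with q(w0) = -1 or 1 in a basis adapted to the signature:
   the A_w with w real and orthogonal to w0 preserve V_R and satisfy the
   relations of Cl_(r-1,s), respectively Cl_(s-1,r). *)

Set Implicit Arguments.
Unset Strict Implicit.
Unset Printing Implicit Defensive.

Import GRing.Theory Num.Theory.
Local Open Scope ring_scope.

(** * Representations of the tensor algebra *)

Section TensorAction.
Variables (F : fieldType) (E V : vectType F) (f : {linear E -> 'End(V)}).

Definition word_act (m : {fmonom 'I_(\dim {:E})}) : 'End(V) :=
  foldr (fun (i : 'I_(\dim {:E})) g => f (vbasis {:E})`_i \o g)%VF \1%VF m.

Lemma word_actM m p : word_act (mmul m p) = (word_act m \o word_act p)%VF.
Proof.
rewrite /word_act fmM foldr_cat.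
by elim: (val m) => [|i s IH] /=; rewrite ?comp_lfun1l // IH comp_lfunA.
Qed.

Definition tensor_act (t : tensor_alg E) : 'End(V) :=
  \sum_(m <- msupp t) t@_m *: word_act m.

(** Summing over any finite set containing the support lets different tensors be compared over a
    common index set. *)
Lemma tensor_actEw (d : {fset {fmonom 'I_(\dim {:E})}}) (t : tensor_alg E) :
  (msupp t `<=` d)%fset -> tensor_act t = \sum_(m <- d) t@_m *: word_act m.
Proof.
move=> le; apply/big_fset_incl => // m _.
by rewrite -mcoeff_eq0 => /eqP ->; rewrite scale0r.
Qed.

Fact tensor_act_linear : linear tensor_act.
Proof.
move=> c s t; pose d := (msupp s `|` msupp t)%fset.
rewrite (@tensor_actEw d); last first.
  apply: fsubset_trans (msuppD_le _ _) _; apply: fsetSU.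
  exact: msuppZ_le.
rewrite (@tensor_actEw d s) ?fsubsetUl // (@tensor_actEw d t) ?fsubsetUr //.
rewrite scaler_sumr -big_split /=; apply: eq_bigr => m _.
by rewrite mcoeffD mcoeffZ scalerDl scalerA.
Qed.

HB.instance Definition _ := GRing.isLinear.Build F (tensor_alg E) 'End(V) _
  tensor_act tensor_act_linear.

Lemma tensor_actU c m : tensor_act << c *g m >> = c *: word_act m.
Proof.
by rewrite (tensor_actEw (msuppU_le (k := m))) big_seq_fset1 mcoeffUU.
Qed.

Lemma tensor_act1 : tensor_act 1 = \1%VF.
Proof. by rewrite tensor_actU scale1r /word_act fm1. Qed.

Lemma tensor_actM s t : tensor_act (s * t) = (tensor_act s \o tensor_act t)%VF.
Proof.
apply/lfunP => x; rewrite malgME linear_sum comp_lfunE !sum_lfunE.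
apply: eq_bigr => m _; rewrite linear_sum sum_lfunE linear_sum.
apply: eq_bigr => p _ /=.
by rewrite tensor_actU word_actM !scale_lfunE comp_lfunE linearZ /= scalerA.
Qed.

Lemma tensor_act_in y : tensor_act (tensor_in y) = f y.
Proof.
rewrite [in RHS](coord_vbasis (memvf y)) !linear_sum; apply: eq_bigr => i _.
by rewrite !linearZ /= tensor_actU scale1r /word_act fmU /= comp_lfun1r.
Qed.

End TensorAction.

(** * Clifford modules from maps squaring to q *)

Section CliffordAction.
Variables (F : fieldType) (E V : vectType F) (q : bilform E).
Variable f : {linear E -> 'End(V)}.
Hypothesis f_sqr : forall y, (f y \o f y)%VF = (q y y : F) *: \1%VF.

(** The tensors acting by zero form a two-sided ideal, and [f_sqr] puts the Clifford relations in
    it. *)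
Lemma tensor_act_ideal t :
  t \in ideal_gen (clifford_rel q) -> tensor_act f t = 0.
Proof.
move=> /asboolP tI; apply: (tI (fun t => tensor_act f t = 0)) => {tI}.
  split=> [|s u s0 u0|s u v u0]; first exact: linear0.
    by rewrite linearD /= s0 u0 addr0.
  by rewrite !tensor_actM u0 comp_lfun0r comp_lfun0l.
move=> _ [y ->].
by rewrite linearB linearZ /= tensor_act1 tensor_actM !tensor_act_in f_sqr subrr.
Qed.

(** The action is defined through a chosen representative; [clifford_act_pi] shows independence of
    the choice. *)
Definition clifford_act (u : clifford q) : 'End(V) := tensor_act f (repr u).

Lemma clifford_act_pi t :
  clifford_act (quot_pi (clifford_rel q) t) = tensor_act f t.
Proof.
apply/subr0_eq; rewrite -linearB.
exact/tensor_act_ideal/quot_repr.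
Qed.

Lemma clifford_act_linear : linear clifford_act.
Proof.
move=> c u v; have [s ->] := quot_piP u; have [t ->] := quot_piP v.
by rewrite -quot_piZ -quot_piD !clifford_act_pi linearP.
Qed.

Lemma clifford_act_unital : unital_action clifford_act.
Proof.
split=> [|u v]; first by rewrite -(tensor_act1 f) -clifford_act_pi.
have [s ->] := quot_piP u; have [t ->] := quot_piP v.
by rewrite -quot_piM !clifford_act_pi tensor_actM.
Qed.

Lemma clifford_module :
  exists rho : {linear clifford q -> 'End(V)}, unital_action rho.
Proof.
pose act : {linear clifford q -> 'End(V)} := HB.pack clifford_act
  (GRing.isLinear.Build F (clifford q) 'End(V) _ _ clifford_act_linear).
exists act; exact: clifford_act_unital.
Qed.

End CliffordAction.

(** * Even Clifford modules from off-diagonal operators *)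

Section EvenCliffordAction.
Variables (F : fieldType) (E V W : vectType F) (q : bilform E).
Variables (f : {linear E -> 'Hom(V, W)}) (g : {linear E -> 'Hom(W, V)}).
Hypothesis gf : forall y, (g y \o f y)%VF = (q y y : F) *: \1%VF.
Hypothesis fg : forall y, (f y \o g y)%VF = (q y y : F) *: \1%VF.

Let swap_fun (y : E) (p : V * W) : V * W := (g y p.2, f y p.1).

Fact swap_fun_linear y : linear (swap_fun y).
Proof. by move=> c [a b] [a' b']; rewrite /swap_fun /= !linearP. Qed.

HB.instance Definition _ y := GRing.isLinear.Build F (V * W)%type (V * W)%type _
  (swap_fun y) (swap_fun_linear y).

Let swap (y : E) : 'End((V * W)%type) := linfun (swap_fun y).

Fact swap_linear : linear swap.
Proof.
move=> c y z; apply/lfunP => -[a b]; rewrite add_lfunE scale_lfunE !lfunE /=.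
by rewrite /swap_fun /= !linearP !add_lfunE !scale_lfunE.
Qed.

HB.instance Definition _ :=
  GRing.isLinear.Build F E 'End((V * W)%type) _ swap swap_linear.

Lemma swap_sqr y : (swap y \o swap y)%VF = (q y y : F) *: \1%VF.
Proof.
apply/lfunP => -[a b]; rewrite comp_lfunE scale_lfunE id_lfunE !lfunE /=.
by rewrite /swap_fun /= -!comp_lfunE gf fg !scale_lfunE !id_lfunE.
Qed.

(** Each letter acts by an off-diagonal operator, so each factor moves the image of V to the other
    summand. *)
Lemma word_act_parity m x :
  let p := word_act swap m (x, 0) in if odd (fdeg m) then p.1 = 0 else p.2 = 0.
Proof.
rewrite /fdeg /word_act /=; elim: (val m) => /= [|i s]; first by rewrite id_lfunE.
by case: (odd _) => /= IH; rewrite comp_lfunE lfunE /= IH linear0.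
Qed.

Let rho0 := clifford_act (q := q) swap.

Lemma even_part_act_pres u x :
  u \in even_part (q := q) -> (rho0 u (x, 0)).2 = 0.
Proof.
move=> /asboolP[t te ->].
rewrite /rho0 (clifford_act_pi swap_sqr) sum_lfunE.
rewrite (big_morph snd (id1 := 0) (op1 := +%R)) //= big_seq big1 // => m mt.
have := word_act_parity m x; rewrite (negbTE (te m mt)) /= => m0.
by rewrite scale_lfunE /= m0 scaler0.
Qed.

Let rho_fun (u : even_clifford q) (x : V) : V := (rho0 (even_val u) (x, 0)).1.

Fact rho_fun_linear u : linear (rho_fun u).
Proof.
move=> c x y; rewrite /rho_fun.
have -> : (c *: x + y, 0) = c *: (x, 0) + (y, 0) :> V * W.
  by apply/eqP; rewrite xpair_eqE /= scaler0 addr0 !eqxx.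
by rewrite linearP.
Qed.

HB.instance Definition _ u :=
  GRing.isLinear.Build F V V _ (rho_fun u) (rho_fun_linear u).

Let rho (u : even_clifford q) : 'End(V) := linfun (rho_fun u).

Fact rho_linear : linear rho.
Proof.
move=> c u v; apply/lfunP => x; rewrite add_lfunE scale_lfunE !lfunE /= /rho_fun.
have -> : even_val (c *: u + v) = c *: even_val u + even_val v by [].
by rewrite /rho0 (clifford_act_linear swap_sqr) add_lfunE scale_lfunE.
Qed.

Lemma even_clifford_module :
  exists rho : {linear even_clifford q -> 'End(V)}, unital_action rho.
Proof.
pose act : {linear even_clifford q -> 'End(V)} := HB.pack rho
  (GRing.isLinear.Build F (even_clifford q) 'End(V) _ _ rho_linear).
exists act.
have [act1 actM] := clifford_act_unital swap_sqr.
split=> [|u v]; apply/lfunP => x.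
  rewrite lfunE /= /rho_fun.
  have -> : even_val (1 : even_clifford q) = 1 by [].
  by rewrite /rho0 act1 !id_lfunE.
rewrite comp_lfunE !lfunE /= /rho_fun.
have -> : even_val (u * v) = even_val u * even_val v by [].
rewrite /rho0 actM comp_lfunE; congr (fst (fun_of_lfun _ _)).
(* Projecting to V between the two factors loses nothing: the even element v keeps (x, 0) in the
   first summand. *)
by rewrite [LHS]surjective_pairing even_part_act_pres //; case: v.
Qed.

End EvenCliffordAction.

(** * Polarization of quadratic identities *)

Lemma quadratic_coef_eq0 (K : fieldType) (V : lmodType K) (X S Y : V) :
  (forall m, (m%:R == 0 :> K) = (m == 0%N)) ->
  (forall a : K, a != 0 -> a ^+ 2 *: X + a *: S + Y = 0) -> X = 0.
Proof.
move=> K0 XSY0.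
(* The values at a = 2, 1, -1 with weights 2, -3, 1 cancel the linear and constant terms. *)
have : 6 *: X = 2 *: (2 ^+ 2 *: X + 2 *: S + Y)
  + (- 3) *: (1 ^+ 2 *: X + 1 *: S + Y) + ((- 1) ^+ 2 *: X + (- 1) *: S + Y).
  rewrite -[X in _ = _ + X]scale1r !scalerDr !scalerA !addrA.
  rewrite [RHS](ACl ((1*4*7)*(2*5*8)*(3*6*9))) /= -!scalerDl.
  have -> : 2 * 2 ^+ 2 + (- 3) * 1 ^+ 2 + 1 * (-1) ^+ 2 = 6 :> K by ring.
  have -> : 2 * 2 + (- 3) * 1 + 1 * (-1) = 0 :> K by ring.
  have -> : 2 + (- 3) + 1 = 0 :> K by ring.
  by rewrite !scale0r !addr0.
rewrite !XSY0 ?oppr_eq0 ?oner_eq0 ?K0 // !scaler0 !addr0.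
by move/eqP; rewrite scaler_eq0 K0 => /eqP.
Qed.

Lemma bilformPl (F : fieldType) (E : vectType F) (q : bilform E) a x y z :
  q (a *: x + y) z = a * q x z + q y z :> F.
Proof. by rewrite linearP add_lfunE scale_lfunE. Qed.

Lemma bilformPr (F : fieldType) (E : vectType F) (q : bilform E) a x y z :
  q z (a *: x + y) = a * q z x + q z y :> F.
Proof. by rewrite linearP. Qed.

(** The defect of the identity is quadratic, so at a w + u it is a polynomial in a whose leading
    coefficient is the defect at w. Excluding a = 0 allows u, like w, to be isotropic. *)
Lemma clifford_sqr_polarize (K : fieldType) (E V : vectType K)
    (L : {linear E -> 'End(V)}) (q : bilform E) (c : K) w u v :
  (forall m, (m%:R == 0 :> K) = (m == 0%N)) ->
  (forall a : K, a != 0 -> c *: L (a *: w + u) (L (a *: w + u) v) =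
     - ((q (a *: w + u) (a *: w + u) : K) *: v)) ->
  c *: L w (L w v) = - ((q w w : K) *: v).
Proof.
move=> K0 H; apply/eqP; rewrite -addr_eq0; apply/eqP.
pose B x y := c *: L x (L y v) + (q x y : K) *: v.
apply: (@quadratic_coef_eq0 _ _ _ (B w u + B u w) (B u u)) => // a a0.
have /eqP := H a a0; rewrite -addr_eq0 => /eqP <-.
rewrite !(bilformPl, bilformPr) (linearP L) !(add_lfunE, scale_lfunE) !linearP.
rewrite /B /= !scalerDr !scalerDl /= !scalerA !mulrDr !scalerDl !mulrA !(mulrC c).
rewrite -expr2 (mulrAC a c a) -expr2 !addrA.
by rewrite [LHS](ACl (1*3*5*7*2*4*6*8)).
Qed.

(** * The endomorphism w0^-1 w attached to two forms *)

Section FormQuotient.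
Variables (F : fieldType) (V : vectType F).

(** [w0^-1] makes sense for every linear map; it is a genuine inverse once [w0] is nondegenerate. *)
Definition form_quo (w0 w : bilform V) : 'End(V) := (w0^-1 \o w)%VF.

Lemma form_quoK (w0 w : bilform V) x : nondegenerate_form w0 ->
  w0 (form_quo w0 w x) = w x.
Proof.
move=> w0_nd; rewrite comp_lfunE limg_lfunVK //.
(* V and its dual have the same dimension, so the injective [w0] is onto. *)
suff -> : limg w0 = fullv by rewrite memvf.
apply/eqP; rewrite eqEdim subvf /= !dimvf limg_dim_eq ?w0_nd ?capv0 //.
by rewrite dimvf -[leqRHS]muln1.
Qed.

Lemma form_quoP (w0 w : bilform V) x y : nondegenerate_form w0 ->
  w0 y = w x -> form_quo w0 w x = y.
Proof.
move=> w0_nd e.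
have /lker0P w0_inj : lker w0 == 0%VS by rewrite w0_nd.
by apply: w0_inj; rewrite form_quoK.
Qed.

Lemma form_quo_linear w0 : linear (form_quo w0).
Proof.
by move=> c w w'; rewrite /form_quo comp_lfunDr comp_lfunZr.
Qed.

End FormQuotient.

(** * Anisotropic and isotropic vectors *)

Section SymmetricForm.
Variables (K : fieldType) (E : vectType K) (q : bilform E).
Hypothesis K0 : forall m, (m%:R == 0 :> K) = (m == 0%N).
Hypothesis qC : forall x y, q x y = q y x.

(** If q vanished on the diagonal, expanding q(x + y, x + y) would give 2 q(x, y) = 0. *)
Lemma anisotropic_vector : q != 0 -> exists w0, q w0 w0 != 0.
Proof.
move=> q_neq0; apply: contrapT => q0; have q00 w : q w w = 0.
  by apply: contrapT => /eqP qw; apply: q0; exists w.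
case/negP: q_neq0; apply/eqP/lfunP => x; apply/lfunP => y.
have := q00 (1 *: x + y); rewrite !(bilformPl, bilformPr) !q00 (qC y x).
rewrite !mul1r add0r addr0 -mulr2n => /eqP.
rewrite -mulr_natr mulf_eq0 K0 orbF => /eqP ->.
by rewrite !zero_lfunE.
Qed.

(** Such a [u] gives q(a w + u) = 2 a q(w, u), so the isotropic w is approached along anisotropic
    vectors orthogonal to w0. *)
Lemma null_partner w0 w : nondegenerate_form q ->
  q w0 w0 != 0 -> w != 0 -> q w0 w = 0 -> q w w = 0 ->
  exists u, [/\ q w0 u = 0, q u u = 0 & q w u != 0].
Proof.
move=> q_nd q0 w_neq0 w0w qw.
have [z qwz] : exists z, q w z != 0.
  apply: contrapT => nz; case/negP: w_neq0; rewrite -memv0 -q_nd memv_ker.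
  apply/eqP/lfunP => z; rewrite zero_lfunE; apply: contrapT => /eqP qwz.
  by apply: nz; exists z.
have [x [w0x wx]] : exists x, q w0 x = 0 /\ q w x != 0.
  (* Projecting z along w0 leaves q(w, z) unchanged, since w is orthogonal to w0. *)
  exists (- (q w0 z / q w0 w0) *: w0 + z).
  by rewrite !bilformPr mulNr divfK ?addNr // (qC w w0) w0w mulr0 add0r.
(* The coefficient solves q(x, x) + 2 c q(w, x) = 0, which is linear in c because w is isotropic. *)
exists (- (q x x / (2 * q w x)) *: w + x); split.
- by rewrite bilformPr w0w w0x mulr0 addr0.
- rewrite !(bilformPl, bilformPr) qw (qC x w); field.
  by rewrite wx K0.
- by rewrite bilformPr qw mulr0 add0r.
Qed.

End SymmetricForm.

(** * From the square identity to an even Clifford module *)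

Section CliffordFromAnisotropic.
Variables (K : fieldType) (E V : vectType K) (L : {linear E -> 'End(V)}).
Variables (q : bilform E) (w0 : E).
Hypothesis K0 : forall m, (m%:R == 0 :> K) = (m == 0%N).
Hypotheses (qC : forall x y, q x y = q y x) (q_nd : nondegenerate_form q).
Hypotheses (q0 : q w0 w0 != 0) (L0 : L w0 = \1%VF).
Hypothesis L_sqr : forall w v, q w0 w = 0 -> q w w != 0 ->
  q w0 w0 *: L w (L w v) = - ((q w w : K) *: v).

Lemma sqr_orthogonal w v : q w0 w = 0 ->
  q w0 w0 *: L w (L w v) = - ((q w w : K) *: v).
Proof.
move=> w0w; have [qw|] := eqVneq (q w w) 0; last exact: L_sqr.
have [->|w_neq0] := eqVneq w 0.
  by rewrite !linear0 !zero_lfunE scaler0 scale0r oppr0.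
(* a w + u is anisotropic for a <> 0, and the identity is polynomial in a. *)
have [u [w0u qu wu]] := null_partner K0 qC q_nd q0 w_neq0 w0w qw.
apply: (clifford_sqr_polarize (u := u)) => // a a0; apply: L_sqr.
  by rewrite bilformPr w0w w0u mulr0 addr0.
rewrite !(bilformPl, bilformPr) qw qu (qC u w) mulr0 add0r addr0 -mulr2n.
by rewrite -mulr_natr mulf_neq0 ?K0 // mulf_neq0.
Qed.

(** For x = a w0 + y with y orthogonal to w0, [L x] is a plus [L y], and [L y] has scalar square; so
    [L x] satisfies a quadratic equation. *)
Lemma sqr_clifford x v :
  q w0 w0 *: L x (L x v) = (2 * q w0 x) *: L x v - (q x x : K) *: v.
Proof.
pose a := q w0 x / q w0 w0; pose y := - a *: w0 + x.
have w0y : q w0 y = 0 by rewrite bilformPr mulNr divfK ?addNr.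
have xE : x = a *: w0 + y by rewrite /y addrA scaleNr subrr add0r.
have := sqr_orthogonal v w0y; move: y w0y xE => y w0y xE.
have xx : q x x = a ^+ 2 * q w0 w0 + q y y.
  by rewrite xE !(bilformPl, bilformPr) (qC y w0) w0y; ring.
have w0x : q w0 x = a * q w0 w0 by rewrite /a divfK.
have LE z : L x z = a *: z + L y z.
  by rewrite {1}xE linearP L0 add_lfunE scale_lfunE id_lfunE.
move=> Ly.
have LyD : L y (a *: v + L y v) = a *: L y v + L y (L y v) by rewrite linearP.
rewrite !LE LyD !scalerDr Ly xx w0x !scalerA -!scaleNr !addrA.
rewrite [LHS](ACl ((1*4)*(2*3))) [RHS](ACl ((1*3)*2)) /= -!scalerDl.
by congr (_ *: _ + _ *: _); rewrite /GRing.scale /=; ring.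
Qed.

Lemma even_clifford_module_of_sqr :
  exists rho : {linear even_clifford q -> 'End(V)}, unital_action rho.
Proof.
pose g x : 'End(V) := (2 * q w0 x) *: \1%VF - q w0 w0 *: L x.
have gL : linear g.
  move=> c x y; rewrite /g bilformPr linearP mulrDr scalerDl scalerDr opprD.
  by rewrite addrACA scalerBr !scalerA mulrCA (mulrC c (q w0 w0)).
pose gLin : {linear E -> 'End(V)} :=
  HB.pack g (GRing.isLinear.Build _ _ _ _ g gL).
apply: (@even_clifford_module _ _ _ _ _ L gLin) => x; apply/lfunP => v;
  rewrite comp_lfunE [RHS]scale_lfunE id_lfunE /= /g;
  rewrite add_lfunE opp_lfunE !scale_lfunE id_lfunE.
  by rewrite sqr_clifford opprB addrC subrK.
rewrite linearB [X in X - _]linearZ [X in _ - X]linearZ /=.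
by rewrite sqr_clifford opprB addrC subrK.
Qed.

End CliffordFromAnisotropic.

(** * The endomorphisms A_w of a k-symplectic structure *)

Section SubvsFormQuotient.
Variables (F : fieldType) (V : vectType F) (Omega : {vspace bilform V}).

Definition subvs_quo (w0 w : subvs_of Omega) : 'End(V) :=
  form_quo (vsval w0) (vsval w).

Lemma subvs_quo_linear w0 : linear (subvs_quo w0).
Proof. by move=> c w w'; rewrite /subvs_quo linearP form_quo_linear. Qed.

HB.instance Definition _ w0 := GRing.isLinear.Build F (subvs_of Omega) 'End(V) _
  (subvs_quo w0) (subvs_quo_linear w0).

End SubvsFormQuotient.

Section KSymplecticSquare.
Variables (K : fieldType) (n : nat) (V : vectType K).
Variables (Omega : {vspace bilform V}) (q : bilform (subvs_of Omega)).
Hypothesis K0 : forall m, (m%:R == 0 :> K) = (m == 0%N).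
Hypothesis K_sqrt : forall c : K, exists t, t ^+ 2 = c.
Hypotheses (dimV : \dim {:V} = (4 * n)%N) (qC : forall x y, q x y = q y x).
Hypothesis q_ker : forall w : subvs_of Omega, w != 0 ->
  \dim (lker (vsval w)) = if q w w == 0 then (2 * n)%N else 0%N.

Lemma ksymp_nondegenerate (w : subvs_of Omega) :
  q w w != 0 -> nondegenerate_form (vsval w).
Proof.
move=> qw; have w_neq0 : w != 0.
  by apply: contraNneq qw => ->; rewrite linear0.
by apply/eqP; rewrite -dimv_eq0 q_ker // (negbTE qw).
Qed.

Variable w0 : subvs_of Omega.
Hypothesis q0 : q w0 w0 != 0.

Let w0_nd := ksymp_nondegenerate q0.

Lemma ksymp_quo_sqr_anisotropic w v : q w0 w = 0 -> q w w != 0 ->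
  q w0 w0 *: subvs_quo w0 w (subvs_quo w0 w v) = - (q w w *: v).
Proof.
move=> w0w qw.
have [t tt] := K_sqrt (- (q w w / q w0 w0)).
have t0 : t != 0.
  by rewrite -sqrf_eq0 tt oppr_eq0 mulf_neq0 ?invr_eq0.
(* The kernel of the pencil member at u lies in the u-eigenspace of A_w. *)
pose U (u : K) := lker (vsval (w - u *: w0)).
have memU u x : x \in U u -> subvs_quo w0 w x = u *: x.
  rewrite memv_ker linearB add_lfunE opp_lfunE linearZ /= scale_lfunE subr_eq0.
  by move=> /eqP e; apply: form_quoP => //; rewrite e linearZ.
have dimU u : u ^+ 2 = t ^+ 2 -> \dim (U u) = (2 * n)%N.
  move=> uu; have nz : w - u *: w0 != 0.
    apply: contraNneq qw => /subr0_eq e.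
    by rewrite {2}e linearZ /= (qC w w0) w0w scaler0.
  rewrite /U (q_ker nz) ifT // addrC -scaleNr.
  rewrite !(bilformPl, bilformPr) (qC w w0) w0w mulr0 addr0 add0r mulrA mulrNN.
  by rewrite -expr2 uu tt mulNr divfK ?addNr.
have cap0 : (U t :&: U (- t) = 0)%VS.
  apply/eqP; rewrite -subv0; apply/subvP => x /memv_capP[/memU e1 /memU].
  rewrite e1 scaleNr => /eqP; rewrite -addr_eq0 -mulr2n -scaler_nat scalerA.
  by rewrite scaler_eq0 mulf_eq0 K0 (negbTE t0) /= memv0.
have dimUU : \dim (U t + U (- t)) = (4 * n)%N.
  rewrite (dimv_disjoint_sum cap0).
  by rewrite (congr2 addn (dimU t (erefl _)) (dimU (- t) (sqrrN t))) -mulnDl.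
have : v \in (U t + U (- t))%VS.
  have /eqP <- : fullv == (U t + U (- t))%VS; last exact: memvf.
  by rewrite eq_sym eqEdim subvf dimV dimUU leqnn.
case/memv_addP => x xU [y yU ->].
rewrite !(linearD (subvs_quo w0 w)) /= (memU _ _ xU) (memU _ _ yU) !linearZ /=.
rewrite (memU _ _ xU) (memU _ _ yU) !scalerA mulrNN -expr2 tt -scalerDr scalerA.
rewrite [RHS]scalerN -scaleNr.
by congr (_ *: _); rewrite mulrN mulrC divfK.
Qed.

Lemma ksymp_quo_sqr_orthogonal w v : nondegenerate_form q -> q w0 w = 0 ->
  q w0 w0 *: subvs_quo w0 w (subvs_quo w0 w v) = - (q w w *: v).
Proof.
move=> q_nd.
exact: (@sqr_orthogonal K _ _ (subvs_quo w0) q w0 K0 qC q_nd q0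
  ksymp_quo_sqr_anisotropic).
Qed.

End KSymplecticSquare.

Section Complexification.
Variables (R : realType) (W : vectType R) (V : vectType R[i]) (iota : W -> V).
Hypothesis iotaC : is_complexification iota.

Lemma complexificationD : {morph iota : x y / x + y}.
Proof. by move=> x y; have := iotaC.1 1 x y; rewrite !scale1r. Qed.

Lemma complexification0 : iota 0 = 0.
Proof. by apply: (addrI (iota 0)); rewrite -complexificationD !addr0. Qed.

Lemma complexificationZ (c : R) x : iota (c *: x) = (c%:C)%C *: iota x.
Proof. by rewrite -[c *: x]addr0 iotaC.1 complexification0 addr0. Qed.

Lemma complexification_inj : injective iota.
Proof.
move=> x y e; suff : (x, 0) = (y, 0) :> W * W by case.
by apply: (bij_inj iotaC.2); rewrite /= e.
Qed.

Lemma complexification_form_eq0 (w : 'Hom(V, R[i]^o)) :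
  (forall x, w (iota x) = 0) -> w = 0.
Proof.
move=> w0; apply/lfunP => v; have [g _ gK] := iotaC.2.
by rewrite zero_lfunE -(gK v) linearD linearZ /= !w0 scaler0 addr0.
Qed.

End Complexification.

Lemma complex_natr_eq0 (R : realType) m : (m%:R == 0 :> R[i]) = (m == 0%N).
Proof. exact: pnatr_eq0. Qed.

Lemma complex_sqrt (R : realType) (c : R[i]) : exists t, t ^+ 2 = c.
Proof. by exists (sqrtc c); rewrite sqr_sqrtc. Qed.

Section RealStructure.
Variables (R : realType) (n k : nat) (V : vectType R[i]).
Variables (Omega : {vspace bilform V}) (q : bilform (subvs_of Omega)).
Variables (VR : vectType R) (iV : VR -> V) (OmegaR : {vspace bilform VR}).
Variables (iOmega : subvs_of OmegaR -> subvs_of Omega).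
Variable qR : bilform (subvs_of OmegaR).
Hypotheses (ksymp : is_ksymplectic n k q) (q_nd : nondegenerate_form q).
Hypothesis real_str : is_real_structure q iV iOmega qR.
Variable w0 : subvs_of OmegaR.
Hypothesis qR0 : qR w0 w0 != 0.

Let qC0 : q (iOmega w0) (iOmega w0) != 0.
Proof. by rewrite (real_qE real_str) (inj_eq (@complexI R)). Qed.

Let W0_nd : nondegenerate_form (vsval (iOmega w0)).
Proof. exact: ksymp_nondegenerate (ksymp_ker ksymp) _ qC0. Qed.

Lemma real_form_nondegenerate : nondegenerate_form (vsval w0).
Proof.
apply/eqP; rewrite -subv0; apply/subvP => x; rewrite memv_ker memv0 => /eqP w0x.
apply/eqP/(complexification_inj (real_V real_str)).
rewrite (complexification0 (real_V real_str)).
have /lker0P : lker (vsval (iOmega w0)) == 0%VS by rewrite W0_nd.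
apply; rewrite linear0.
apply: (complexification_form_eq0 (real_V real_str)) => y.
by rewrite (real_OmegaE real_str) w0x zero_lfunE.
Qed.

Lemma complexification_quo (w : subvs_of OmegaR) x :
  subvs_quo (iOmega w0) (iOmega w) (iV x) = iV (subvs_quo w0 w x).
Proof.
apply: form_quoP; first exact: W0_nd.
apply/subr0_eq/(complexification_form_eq0 (real_V real_str)) => y.
rewrite add_lfunE opp_lfunE !(real_OmegaE real_str) form_quoK ?subrr //.
exact: real_form_nondegenerate.
Qed.

Lemma real_quo_sqr (w : subvs_of OmegaR) v : qR w0 w = 0 ->
  qR w0 w0 *: subvs_quo w0 w (subvs_quo w0 w v) =
  - ((qR w w : R) *: v).
Proof.
move=> w0w; apply: (complexification_inj (real_V real_str)).
rewrite -scaleNr !(complexificationZ (real_V real_str)) -!complexification_quo.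
rewrite rmorphN scaleNr -!(real_qE real_str).
have W0W : q (iOmega w0) (iOmega w) = 0 by rewrite (real_qE real_str) w0w.
rewrite (ksymp_quo_sqr_orthogonal (@complex_natr_eq0 R) (complex_sqrt (R := R))
  (ksymp_dimV ksymp) (ksymp_sym ksymp) (ksymp_ker ksymp) qC0 (iV v) q_nd W0W).
by rewrite (real_qE real_str).
Qed.

Lemma real_Cl_module r s (e : 'I_(r + s) -> subvs_of OmegaR) :
  (forall i, qR w0 (e i) = 0) ->
  (forall i j, qR (e i) (e j) =
     if i == j then - ((-1) ^+ (i < r)%N * qR w0 w0) else 0) ->
  exists rho : {linear Cl R r s -> 'End(VR)}, unital_action rho.
Proof.
move=> w0e ee.
pose g (y : 'rV[R]_(r + s)) := \sum_i y 0 i *: e i.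
have gL : linear g.
  move=> c x y; rewrite /g scaler_sumr -big_split /=; apply: eq_bigr => i _.
  by rewrite !mxE scalerDl scalerA.
pose gLin : {linear _ -> _} := HB.pack g (GRing.isLinear.Build _ _ _ _ g gL).
have w0g y : qR w0 (g y) = 0.
  by rewrite linear_sum big1 // => i _; rewrite linearZ /= w0e scaler0.
have gg y : qR (g y) (g y) = - (qR w0 w0 * std_form R r s y y).
  rewrite std_formE mulr_sumr -sumrN linear_sum /=; apply: eq_bigr => i _.
  rewrite linearZ /= /g linear_sum sum_lfunE.
  rewrite (bigD1 i) //= big1 => [|j ji].
    by rewrite linearZ /= scale_lfunE ee eqxx addr0 /GRing.scale /=; ring.
  by rewrite linearZ /= scale_lfunE ee (negbTE ji) scaler0.
apply: (@clifford_module _ _ _ (std_form R r s)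
  (subvs_quo w0 \o gLin)) => y.
apply/lfunP => v; rewrite comp_lfunE scale_lfunE id_lfunE /=.
apply: (scalerI qR0); rewrite real_quo_sqr ?w0g // gg scalerA.
by rewrite scaleNr opprK.
Qed.

End RealStructure.

Lemma ksymp_even_clifford_module (R : realType) (n k : nat) (V : vectType R[i])
    (Omega : {vspace bilform V}) (q : bilform (subvs_of Omega)) :
  is_ksymplectic n k q -> nondegenerate_form q ->
  exists rho : {linear even_clifford q -> 'End(V)}, unital_action rho.
Proof.
move=> ksymp q_nd.
have [w0 q0] := anisotropic_vector (@complex_natr_eq0 R) (ksymp_sym ksymp)
  (ksymp_neq0 ksymp).
have w0_nd := ksymp_nondegenerate (ksymp_ker ksymp) q0.
apply: (@even_clifford_module_of_sqr _ _ _ (subvs_quo w0) q w0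
  (@complex_natr_eq0 R) (ksymp_sym ksymp) q_nd q0) => [|w v w0w qw].
  by apply/lfunP => z; rewrite id_lfunE; apply: form_quoP.
exact: (ksymp_quo_sqr_anisotropic (@complex_natr_eq0 R)
  (complex_sqrt (R := R)) (ksymp_dimV ksymp)
  (ksymp_sym ksymp) (ksymp_ker ksymp) q0 v w0w qw).
Qed.

Theorem proposition2p11 (R : realType) :
  (forall (n k : nat) (V : vectType R[i]) (Omega : {vspace bilform V})
      (q : bilform (subvs_of Omega)),
    is_ksymplectic n k q -> nondegenerate_form q ->
    exists rho : {linear even_clifford q -> 'End(V)}, unital_action rho)
  /\
  (forall (n k : nat) (V : vectType R[i]) (Omega : {vspace bilform V})
      (q : bilform (subvs_of Omega))
      (VR : vectType R) (iV : VR -> V) (OmegaR : {vspace bilform VR})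
      (iOmega : subvs_of OmegaR -> subvs_of Omega)
      (qR : bilform (subvs_of OmegaR)) (r s : nat),
    is_ksymplectic n k q -> nondegenerate_form q ->
    is_real_structure q iV iOmega qR -> has_signature qR r s ->
    ((0 < r)%N ->
      exists rho : {linear Cl R r.-1 s -> 'End(VR)}, unital_action rho) /\
    ((0 < s)%N ->
      exists rho : {linear Cl R s.-1 r -> 'End(VR)}, unital_action rho)).
Proof.
split=> [n k V Omega q|n k V Omega q VR iV OmegaR iOmega qR r s].
  exact: ksymp_even_clifford_module.
move=> ksymp q_nd real_str [e _ ee]; split=> [r_gt0|s_gt0].
  case: r r_gt0 e ee => // r _ e ee.
  have i0P : qR (tnth e ord0) (tnth e ord0) = -1 by rewrite ee eqxx.
  apply: (@real_Cl_module R n k V Omega q VR iV OmegaR iOmega qR ksymp q_nd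
    real_str (tnth e ord0) _ r s (fun i => tnth e (lift ord0 i))).
  - by rewrite i0P oppr_eq0 oner_eq0.
  - by move=> i; rewrite ee (negbTE (neq_lift _ _)).
  - move=> i j; rewrite ee i0P mulrN1 opprK (inj_eq (@lift_inj _ ord0)).
    by case: eqP => // ->.
case: s s_gt0 e ee => // s _ e ee.
(* Taking w0 positive changes the sign of q on its complement, so the s pluses
   left over become the minuses of Cl_(s,r) and have to come first. *)
pose swap (i : 'I_(s + r)) : 'I_(r + s.+1) :=
  match split i with
  | inl j => rshift r (widen_ord (leqnSn s) j) | inr j => lshift s.+1 j end.
have eq_swap i j : (swap i == swap j) = (i == j).
  rewrite -(splitK i) -(splitK j) /swap !unsplitK.
  by case: (split i) (split j) => [i'|i'] [j'|j'] /=;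
    rewrite ?eq_lshift ?eq_rshift ?eq_lrshift ?eq_rlshift.
have swap_max i : (rshift r ord_max == swap i) = false.
  rewrite /swap; case: split => j; rewrite ?eq_rlshift // eq_rshift.
  by apply/negP => /eqP/(congr1 val) /= e_s; have := ltn_ord j; rewrite -e_s ltnn.
have swap_lt i : (swap i < r)%N = ~~ (i < s)%N.
  rewrite /swap; case: (splitP i) => j _ /=; last by rewrite ltn_ord.
  by rewrite ltnNge leq_addr.
have emax : qR (tnth e (rshift r ord_max)) (tnth e (rshift r ord_max)) = 1.
  by rewrite ee eqxx /= ltnNge leq_addr.
apply: (@real_Cl_module R n k V Omega q VR iV OmegaR iOmega qR ksymp q_nd
  real_str (tnth e (rshift r ord_max)) _ s r (fun i => tnth e (swap i))).
- by rewrite emax oner_eq0.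
- by move=> i; rewrite ee swap_max.
- move=> i j; rewrite ee emax mulr1 eq_swap; case: eqP => // _.
  by rewrite swap_lt; case: (i < s)%N; rewrite /= ?expr0 ?expr1 ?opprK.
Qed.
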